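(* Let $\phi_0\in\mathfrak L_m(\mathbb K)$ be the law of a Lie algebra $\mathfrak g$ which is the semi-direct product $\mathrm R\ltimes\mathfrak n$ of a reductive part $\mathrm R=\langle e_{n+1},\dots,e_m\rangle$ by a nilpotent part $\mathfrak n=\langle e_1,\dots,e_n\rangle$, $n\le m$. Let $\mathcal A$ be the set of multi-indices $\binom k{ij}$ ($1\le i<j\le m$, $1\le k\le m$) such that $i$, $j$ or $k$ is $>n$, and let $\mathfrak L^{\mathcal A}_{m,\phi_0}$ be the subscheme of $\mathfrak L_m$ defined by $\mathcal A$ and $\phi_0$. Then there is an isomorphism of schemes $\mathfrak L^{\mathcal A}_{m,\phi_0}\simeq\mathfrak L_n^{\mathrm R}$.
   Context: $\mathbb K$ is an algebraically closed field of characteristic $0$, $(e_i)$ the canonical basis of $\mathbb K^m$. $\mathfrak L_m$ is the affine $\mathbb K$-scheme whose $A$-points ($A$ a commutative $\mathbb K$-algebra) are the Lie $A$-algebra multiplications $\phi=(\phi^k_{ij})$ on $A\otimes\mathbb K^m$. $\mathfrak L^{\mathcal A}_{m,\phi_0}$ is the closed subscheme with $\mathfrak L^{\mathcal A}_{m,\phi_0}(A)=\{\phi\in\mathfrak L_m(A):\phi^\alpha=(\phi_0)^\alpha\ \forall\alpha\in\mathcal A\}$. $\mathfrak L_n^{\mathrm R}$ is the closed subscheme of $\mathfrak L_n$ consisting of the laws $\varphi$ on $\mathbb K^n=\mathfrak n$ with $\delta\varphi(x,y)=\varphi(\delta x,y)+\varphi(x,\delta y)$ for all $\delta\in\mathrm{ad}_{\mathfrak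 n}\mathrm R$, where $\mathrm{ad}_{\mathfrak n}\mathrm R$ is the set of restrictions to $\mathfrak n$ of $\phi_0(x,\cdot)$, $x\in\mathrm R$. In the semi-direct product, $\mathfrak n$ is a nilpotent ideal and $\mathrm R$ a reductive subalgebra. *)

(* Defs.v *)
From HB Require Import structures.
From mathcomp Require Import all_boot all_order all_algebra.
From mathcomp Require Import boolp.

Set Implicit Arguments.
Unset Strict Implicit.
Unset Printing Implicit Defensive.

Import GRing.Theory.
Local Open Scope ring_scope.
Local Open Scope quotient_scope.

(* A commutative K-algebra, as a ring under K. Unlike comAlgType K, this      *)
(* includes the zero algebra.                                                 *)
Record kalg (K : fieldType) := KAlg {
  kalg_ring :> comPzRingType;
  kalg_str : {rmorphism K -> kalg_ring}
}.

Record khom (K : fieldType) (A B : kalg K) := KHom {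
  khom_fun :> {rmorphism A -> B};
  khom_str : forall a : K, khom_fun (kalg_str A a) = kalg_str B a
}.

Definition kself (K : fieldType) : kalg K := KAlg (idfun : {rmorphism K -> K}).

Definition khom_id (K : fieldType) (A : kalg K) : khom A A :=
  @KHom K A A (idfun : {rmorphism A -> A}) (fun=> erefl).

Lemma khom_comp_str (K : fieldType) (A B C : kalg K)
    (g : khom B C) (f : khom A B) (a : K) :
  (g \o f : {rmorphism A -> C}) (kalg_str A a) = kalg_str C a.
Proof. by rewrite /= !khom_str. Qed.

Definition khom_comp (K : fieldType) (A B C : kalg K)
    (g : khom B C) (f : khom A B) : khom A C :=
  KHom (khom_comp_str g f).

(* Affine K-schemes are the representable functors from commutative           *)
(* K-algebras to sets, and their morphisms are the natural transformations.   *)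
Record kfunctor (K : fieldType) := KFunctor {
  points :> kalg K -> Type;
  pmap : forall A B : kalg K, khom A B -> points A -> points B;
  pmap_id : forall (A : kalg K) (x : points A), pmap (khom_id A) x = x;
  pmap_comp : forall (A B C : kalg K) (g : khom B C) (f : khom A B)
    (x : points A), pmap (khom_comp g f) x = pmap g (pmap f x)
}.

Definition representable (K : fieldType) (F : kfunctor K) : Prop :=
  exists (C : kalg K) (u : F C), forall (A : kalg K) (x : F A),
    (exists f : khom C A, pmap f u = x) /\
    (forall f g : khom C A, pmap f u = x -> pmap g u = x -> f =1 g).

Record affine_scheme (K : fieldType) := AffineScheme {
  functor_of_points :> kfunctor K;
  affine_representable : representable functor_of_points
}.

Definition scheme_iso (K : fieldType) (F G : affine_scheme K) : Prop :=
  exists u : forall A : kalg K, F A -> G A,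
    (forall (A B : kalg K) (f : khom A B) (x : F A),
       u B (pmap f x) = pmap f (u A x)) /\
    (forall A : kalg K, bijective (u A)).

(* Structure constants, phi (i, j, k) being the coefficient phi^k_{ij} of e_k *)
(* in phi(e_i, e_j); indices are numbered from 0.                             *)
Definition law (m : nat) (A : Type) := {ffun 'I_m * 'I_m * 'I_m -> A}.

Definition map_law (m : nat) (A B : Type) (f : A -> B) (phi : law m A) :
  law m B := [ffun a => f (phi a)].

Definition bracket (m : nat) (A : comPzRingType) (phi : law m A)
    (x y : 'rV[A]_m) : 'rV[A]_m :=
  \row_k \sum_i \sum_j x 0 i * y 0 j * phi (i, j, k).

Definition is_lie (m : nat) (A : comPzRingType) (phi : law m A) : Prop :=
  (forall x, bracket phi x x = 0) /\
  (forall x y z, bracket phi x (bracket phi y z)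
               + bracket phi y (bracket phi z x)
               + bracket phi z (bracket phi x y) = 0).

Definition fixed_on (K : fieldType) (m : nat)
    (S : {set 'I_m * 'I_m * 'I_m}) (phi0 : law m K)
    (A : kalg K) (phi : law m A) : Prop :=
  forall a, a \in S -> phi a = kalg_str A (phi0 a).

(* The matrix d is the endomorphism y |-> y *m d of K^n.                      *)
Definition derived_by (K : fieldType) (n : nat) (D : 'M[K]_n -> Prop)
    (A : kalg K) (phi : law n A) : Prop :=
  forall d, D d -> let dA := map_mx (kalg_str A) d in
  forall x y : 'rV[A]_n, bracket phi x y *m dA
    = bracket phi (x *m dA) y + bracket phi x (y *m dA).

(* A condition on laws defines a subfunctor of the affine space of structure  *)
(* constants; detecting it on jointly injective families of morphisms makes   *)
(* this subfunctor closed, hence representable.                               *)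
Record closed_cond (K : fieldType) (m : nat) := ClosedCond {
  cond :> forall A : kalg K, law m A -> Prop;
  cond_map : forall (A B : kalg K) (f : khom A B) (phi : law m A),
    cond phi -> cond (map_law f phi);
  cond_detect : forall (A : kalg K) (phi : law m A),
    (forall a b : A,
       (forall (B : kalg K) (f : khom A B), cond (map_law f phi) -> f a = f b)
       -> a = b) ->
    cond phi
}.

Lemma map_law_id (K : fieldType) (m : nat) (A : kalg K) (phi : law m A) :
  map_law (khom_id A) phi = phi.
Proof. by apply/ffunP => a; rewrite ffunE. Qed.

Lemma map_law_comp (K : fieldType) (m : nat) (A B C : kalg K)
    (g : khom B C) (f : khom A B) (phi : law m A) :
  map_law (khom_comp g f) phi = map_law g (map_law f phi).
Proof. by apply/ffunP => a; rewrite !ffunE. Qed.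

Section LawFunctor.
Variables (K : fieldType) (m : nat) (P : closed_cond K m).

Definition law_points (A : kalg K) : Type := {phi : law m A | P A phi}.

Definition law_pmap (A B : kalg K) (f : khom A B) (phi : law_points A) :
  law_points B := exist _ (map_law f (sval phi)) (cond_map f (svalP phi)).

Lemma law_points_inj (A : kalg K) (phi psi : law_points A) :
  sval phi = sval psi -> phi = psi.
Proof. by case: phi psi => [p hp] [q hq] /= e; exact: eq_exist. Qed.

Lemma law_pmap_id (A : kalg K) (x : law_points A) :
  law_pmap (khom_id A) x = x.
Proof. by apply: law_points_inj; rewrite /= map_law_id. Qed.

Lemma law_pmap_comp (A B C : kalg K) (g : khom B C) (f : khom A B)
    (x : law_points A) :
  law_pmap (khom_comp g f) x = law_pmap g (law_pmap f x).
Proof. by apply: law_points_inj; rewrite /= map_law_comp. Qed.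

Definition law_functor : kfunctor K := KFunctor law_pmap_id law_pmap_comp.

End LawFunctor.

(* Coordinate ring of the subfunctor: polynomial expressions in the structure *)
(* constants, modulo equality at all points.                                  *)
Inductive pexpr (K : Type) (I : Type) :=
| PVar of I
| PCst of K
| PAdd of pexpr K I & pexpr K I
| PMul of pexpr K I & pexpr K I.
Arguments PCst {K I}.
Arguments PVar {K I}.

Section CoordinateRing.
Variables (K : fieldType) (m : nat) (P : closed_cond K m).

Definition lexpr : choiceType := {classic pexpr K ('I_m * 'I_m * 'I_m)}.

Fixpoint peval (A : kalg K) (phi : law m A)
    (t : pexpr K ('I_m * 'I_m * 'I_m)) : A :=
  match t with
  | PVar a => phi a
  | PCst k => kalg_str A k
  | PAdd t s => peval phi t + peval phi s
  | PMul t s => peval phi t * peval phi s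
  end.

Definition coord_rel : rel lexpr := fun t s =>
  `[< forall (A : kalg K) (phi : law m A), P A phi -> peval phi t = peval phi s >].

Lemma coord_rel_refl : reflexive coord_rel.
Proof. by move=> t; apply/asboolP. Qed.

Lemma coord_rel_sym : symmetric coord_rel.
Proof.
by move=> t s; apply/asboolP/asboolP => h A phi Pphi; rewrite h.
Qed.

Lemma coord_rel_trans : transitive coord_rel.
Proof.
move=> t s r /asboolP h1 /asboolP h2; apply/asboolP => A phi Pphi.
by rewrite h1 // h2.
Qed.

Canonical coord_equiv :=
  EquivRel coord_rel coord_rel_refl coord_rel_sym coord_rel_trans.

Definition coord := {eq_quot coord_rel}.
HB.instance Definition _ := Choice.on coord.

Definition cev (A : kalg K) (phi : law m A) (x : coord) : A :=
  peval phi (repr x).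

Lemma cev_pi (A : kalg K) (phi : law m A) (t : lexpr) :
  P A phi -> cev phi (\pi_coord t) = peval phi t.
Proof.
move=> Pphi; rewrite /cev.
have /eqmodP/asboolP -> // : repr (\pi_coord t) = t %[mod coord].
by rewrite reprK.
Qed.

Lemma coord_ext (x y : coord) :
  (forall (A : kalg K) (phi : law m A), P A phi -> cev phi x = cev phi y) ->
  x = y.
Proof.
move=> h; rewrite -[x]reprK -[y]reprK; apply/eqmodP/asboolP => A phi Pphi.
exact: h.
Qed.

Definition ccst (k : K) : coord := \pi_coord (PCst k : lexpr).
Definition cadd (x y : coord) : coord :=
  \pi_coord (PAdd (repr x) (repr y) : lexpr).
Definition cmul (x y : coord) : coord :=
  \pi_coord (PMul (repr x) (repr y) : lexpr).
Definition copp (x : coord) : coord := cmul (ccst (-1)) x.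

Lemma cev_cst (A : kalg K) (phi : law m A) k :
  P A phi -> cev phi (ccst k) = kalg_str A k.
Proof. exact: cev_pi. Qed.

Lemma cev_add (A : kalg K) (phi : law m A) x y :
  P A phi -> cev phi (cadd x y) = cev phi x + cev phi y.
Proof. exact: cev_pi. Qed.

Lemma cev_mul (A : kalg K) (phi : law m A) x y :
  P A phi -> cev phi (cmul x y) = cev phi x * cev phi y.
Proof. exact: cev_pi. Qed.

Lemma cev_opp (A : kalg K) (phi : law m A) x :
  P A phi -> cev phi (copp x) = - cev phi x.
Proof. by move=> h; rewrite cev_mul // cev_cst // rmorphN1 mulN1r. Qed.

Lemma caddA : associative cadd.
Proof. by move=> x y z; apply: coord_ext => A p h; rewrite !cev_add // addrA. Qed.
Lemma caddC : commutative cadd.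
Proof. by move=> x y; apply: coord_ext => A p h; rewrite !cev_add // addrC. Qed.
Lemma cadd0 : left_id (ccst 0) cadd.
Proof.
by move=> x; apply: coord_ext => A p h; rewrite cev_add // cev_cst // rmorph0 add0r.
Qed.
Lemma caddN : left_inverse (ccst 0) copp cadd.
Proof.
move=> x; apply: coord_ext => A p h.
by rewrite cev_add // cev_opp // cev_cst // rmorph0 addNr.
Qed.
HB.instance Definition _ := GRing.isZmodule.Build coord caddA caddC cadd0 caddN.

Lemma cmulA : associative cmul.
Proof. by move=> x y z; apply: coord_ext => A p h; rewrite !cev_mul // mulrA. Qed.
Lemma cmulC : commutative cmul.
Proof. by move=> x y; apply: coord_ext => A p h; rewrite !cev_mul // mulrC. Qed.
Lemma cmul1 : left_id (ccst 1) cmul.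
Proof.
by move=> x; apply: coord_ext => A p h; rewrite cev_mul // cev_cst // rmorph1 mul1r.
Qed.
Lemma cmulD : left_distributive cmul +%R.
Proof.
move=> x y z; apply: coord_ext => A p h.
by rewrite cev_mul // !cev_add // !cev_mul // mulrDl.
Qed.
HB.instance Definition _ :=
  GRing.Zmodule_isComPzRing.Build coord cmulA cmulC cmul1 cmulD.

Lemma ccst_zmod : zmod_morphism ccst.
Proof.
move=> a b; apply: coord_ext => A p h.
by rewrite cev_add // cev_opp // !cev_cst // rmorphB.
Qed.
Lemma ccst_monoid : monoid_morphism ccst.
Proof.
split=> // a b; apply: coord_ext => A p h.
by rewrite cev_mul // !cev_cst // rmorphM.
Qed.
HB.instance Definition _ := GRing.isZmodMorphism.Build K coord ccst ccst_zmod.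
HB.instance Definition _ := GRing.isMonoidMorphism.Build K coord ccst ccst_monoid.

Definition coord_kalg : kalg K := KAlg (ccst : {rmorphism K -> coord}).

Definition coord_law : law m coord_kalg :=
  [ffun a => \pi_coord (PVar a : lexpr)].

Section Evaluation.
Variables (A : kalg K) (phi : law m A) (Pphi : P A phi).

Definition cev_at of P A phi := cev phi.
Local Notation ev := (cev_at Pphi).

Lemma cev_zmod : zmod_morphism ev.
Proof. by move=> x y; rewrite /cev_at cev_add // cev_opp. Qed.
Lemma cev_monoid : monoid_morphism ev.
Proof.
by split=> [|x y]; rewrite /cev_at ?cev_mul // cev_cst // rmorph1.
Qed.
HB.instance Definition _ := GRing.isZmodMorphism.Build coord A ev cev_zmod.
HB.instance Definition _ := GRing.isMonoidMorphism.Build coord A ev cev_monoid.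

Definition cev_khom : khom coord_kalg A :=
  @KHom K coord_kalg A (ev : {rmorphism coord -> A})
    (fun k => cev_cst k Pphi).

Lemma cev_law : map_law cev_khom coord_law = phi.
Proof. by apply/ffunP => a; rewrite !ffunE /= /cev_at cev_pi. Qed.

End Evaluation.

Lemma coord_lawP : P coord_kalg coord_law.
Proof.
apply: cond_detect => a b h; apply: coord_ext => A phi Pphi.
by apply: (h A (cev_khom Pphi)); rewrite cev_law.
Qed.

Lemma coord_khom_inj (A : kalg K) (f g : khom coord_kalg A) :
  map_law f coord_law = map_law g coord_law -> f =1 g.
Proof.
move=> e x; rewrite -[x](reprK (x : coord)).
elim: (repr (x : coord)) => [a|k|t IHt s IHs|t IHt s IHs].
- by move/ffunP/(_ a): e; rewrite !ffunE.
- exact: etrans (khom_str f k) (esym (khom_str g k)).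
- have -> : \pi_coord (PAdd t s : lexpr)
      = (\pi_coord (t : lexpr) : coord) + \pi_coord (s : lexpr) :> coord.
    by apply: coord_ext => B p h; rewrite cev_add // !cev_pi.
  by rewrite !(rmorphD f) !(rmorphD g) IHt IHs.
- have -> : \pi_coord (PMul t s : lexpr)
      = (\pi_coord (t : lexpr) : coord) * \pi_coord (s : lexpr) :> coord.
    by apply: coord_ext => B p h; rewrite cev_mul // !cev_pi.
  by rewrite !(rmorphM f) !(rmorphM g) IHt IHs.
Qed.

Lemma law_functor_representable : representable (law_functor P).
Proof.
exists coord_kalg, (exist _ coord_law coord_lawP) => A [phi Pphi]; split.
  by exists (cev_khom Pphi); apply: law_points_inj; rewrite /= cev_law.
move=> f g /(congr1 sval) /= ef /(congr1 sval) /= eg.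
by apply: coord_khom_inj; rewrite ef eg.
Qed.

Definition law_scheme : affine_scheme K :=
  AffineScheme law_functor_representable.

End CoordinateRing.

Lemma map_bracket (m : nat) (A B : comPzRingType) (f : {rmorphism A -> B})
    (phi : law m A) (x y : 'rV[A]_m) :
  map_mx f (bracket phi x y) = bracket (map_law f phi) (map_mx f x) (map_mx f y).
Proof.
apply/rowP => k; rewrite !mxE rmorph_sum; apply: eq_bigr => i _.
by rewrite rmorph_sum; apply: eq_bigr => j _; rewrite !rmorphM !mxE ffunE.
Qed.

Section Bilinearity.
Variables (A : comPzRingType) (m : nat) (phi : law m A).
Local Notation br := (bracket phi).

Lemma bracketDl x y z : br (x + y) z = br x z + br y z.
Proof.
apply/rowP => k; rewrite !mxE -big_split; apply: eq_bigr => i _ /=.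
by rewrite -big_split; apply: eq_bigr => j _ /=; rewrite !mxE !mulrDl.
Qed.

Lemma bracketDr x y z : br z (x + y) = br z x + br z y.
Proof.
apply/rowP => k; rewrite !mxE -big_split; apply: eq_bigr => i _ /=.
by rewrite -big_split; apply: eq_bigr => j _ /=; rewrite !mxE mulrDr mulrDl.
Qed.

Lemma bracketZl a x z : br (a *: x) z = a *: br x z.
Proof.
apply/rowP => k; rewrite !mxE mulr_sumr; apply: eq_bigr => i _ /=.
by rewrite mulr_sumr; apply: eq_bigr => j _ /=; rewrite !mxE !mulrA.
Qed.

Lemma bracketZr a x z : br z (a *: x) = a *: br z x.
Proof.
apply/rowP => k; rewrite !mxE mulr_sumr; apply: eq_bigr => i _ /=.
rewrite mulr_sumr; apply: eq_bigr => j _ /=.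
by rewrite !mxE !mulrA [z 0 i * a]mulrC.
Qed.

Lemma row_basis_ind p (g : 'rV[A]_m -> 'rV[A]_p) :
  (forall x y, g (x + y) = g x + g y) -> (forall a x, g (a *: x) = a *: g x) ->
  (forall i, g (delta_mx 0 i) = 0) -> forall x, g x = 0.
Proof.
move=> gD gZ g0 x; rewrite [x]row_sum_delta.
elim/big_rec: _ => [|i y _ gy]; first by rewrite -[0](scale0r 0) gZ scale0r.
by rewrite gD gZ g0 gy scaler0 addr0.
Qed.

Lemma bracket_antisym :
  (forall x, br x x = 0) -> forall x y, br x y + br y x = 0.
Proof.
move=> h x y; have := h (x + y).
by rewrite bracketDl !bracketDr !h add0r addr0.
Qed.

End Bilinearity.

Lemma map_delta (A B : comPzRingType) (f : {rmorphism A -> B}) (m : nat)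
    (i : 'I_m) : delta_mx 0 i = map_mx f (delta_mx 0 i) :> 'rV[B]_m.
Proof. by rewrite map_delta_mx. Qed.

Lemma is_lie_map (K : fieldType) (m : nat) (A B : kalg K) (f : khom A B)
    (phi : law m A) : is_lie phi -> is_lie (map_law f phi).
Proof.
move=> [alt jac]; set psi := map_law f phi.
have anti x y : bracket psi x y + bracket psi y x = 0.
  move: x; apply: row_basis_ind => [x z|a x|i].
  - by rewrite bracketDl bracketDr addrACA.
  - by rewrite bracketZl bracketZr scalerDr.
  move: y; apply: row_basis_ind => [x z|a x|j].
  - by rewrite bracketDl bracketDr addrACA.
  - by rewrite bracketZl bracketZr scalerDr.
  rewrite !(map_delta f) -!map_bracket -raddfD /=.
  by rewrite bracket_antisym // raddf0.
split=> [x|x y z].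
  rewrite [x]row_sum_delta; elim/big_rec: _ => [|i y _ IH].
    by rewrite -{1}(scale0r (0 : 'rV_m)) bracketZl scale0r.
  rewrite bracketDl !bracketDr IH addr0 -addrA anti addr0.
  rewrite bracketZl bracketZr (map_delta f) -map_bracket alt.
  by rewrite raddf0 !scaler0.
move: x; apply: row_basis_ind => [x x'|a x|i].
- by rewrite !(bracketDl, bracketDr) [X in X + _ = _]addrACA [LHS]addrACA.
- by rewrite !(bracketZl, bracketZr) !scalerDr.
move: y; apply: row_basis_ind => [y y'|a y|j].
- by rewrite !(bracketDl, bracketDr) [X in X + _ = _]addrACA [LHS]addrACA.
- by rewrite !(bracketZl, bracketZr) !scalerDr.
move: z; apply: row_basis_ind => [z z'|a z|k].
- by rewrite !(bracketDl, bracketDr) [X in X + _ = _]addrACA [LHS]addrACA.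
- by rewrite !(bracketZl, bracketZr) !scalerDr.
by rewrite !(map_delta f) -!map_bracket -!raddfD /= jac raddf0.
Qed.

Lemma is_lie_detect (K : fieldType) (m : nat) (A : kalg K) (phi : law m A) :
  (forall a b : A,
     (forall (B : kalg K) (f : khom A B), is_lie (map_law f phi) -> f a = f b)
     -> a = b) ->
  is_lie phi.
Proof.
move=> sep; split=> [x|x y z]; apply/rowP => k; apply: sep => B f [alt jac].
  have : map_mx f (bracket phi x x) = map_mx f 0 by rewrite map_bracket alt raddf0.
  by move/rowP/(_ k); rewrite !mxE.
have : map_mx f (bracket phi x (bracket phi y z) + bracket phi y (bracket phi z x)
    + bracket phi z (bracket phi x y)) = map_mx f 0.
  by rewrite !raddfD /= !map_bracket jac raddf0.
by move/rowP/(_ k); rewrite [LHS]mxE [RHS]mxE.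
Qed.

Definition lie_cond (K : fieldType) (m : nat) : closed_cond K m :=
  ClosedCond (@is_lie_map K m) (@is_lie_detect K m).

Lemma fixed_on_map (K : fieldType) (m : nat) (S : {set 'I_m * 'I_m * 'I_m})
    (phi0 : law m K) (A B : kalg K) (f : khom A B) (phi : law m A) :
  fixed_on S phi0 phi -> fixed_on S phi0 (map_law f phi).
Proof. by move=> h a aS; rewrite ffunE h // khom_str. Qed.

Lemma fixed_on_detect (K : fieldType) (m : nat) (S : {set 'I_m * 'I_m * 'I_m})
    (phi0 : law m K) (A : kalg K) (phi : law m A) :
  (forall a b : A,
     (forall (B : kalg K) (f : khom A B),
        fixed_on S phi0 (map_law f phi) -> f a = f b) -> a = b) ->
  fixed_on S phi0 phi.
Proof.
move=> sep a aS; apply: sep => B f /(_ a aS).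
by rewrite ffunE khom_str.
Qed.

Definition fixed_cond (K : fieldType) (m : nat) (S : {set 'I_m * 'I_m * 'I_m})
    (phi0 : law m K) : closed_cond K m :=
  ClosedCond (@fixed_on_map K m S phi0) (@fixed_on_detect K m S phi0).

Lemma map_str (K : fieldType) (n p : nat) (A B : kalg K) (f : khom A B)
    (d : 'M[K]_(n, p)) :
  map_mx (kalg_str B) d = map_mx f (map_mx (kalg_str A) d).
Proof. by apply/matrixP => i j; rewrite !mxE khom_str. Qed.

Lemma derived_by_map (K : fieldType) (n : nat) (D : 'M[K]_n -> Prop)
    (A B : kalg K) (f : khom A B) (phi : law n A) :
  derived_by D phi -> derived_by D (map_law f phi).
Proof.
move=> h d Dd /= x y; apply/eqP; rewrite -subr_eq0; apply/eqP.
move: x; apply: row_basis_ind => [x z|a x|i].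
- by rewrite !(bracketDl, mulmxDl) [X in _ - X]addrACA opprD addrACA.
- by rewrite -!scalemxAl !bracketZl -scalemxAl -scalerDr -scalerBr.
move: y; apply: row_basis_ind => [y z|a y|j].
- by rewrite !(bracketDr, mulmxDl) [X in _ - X]addrACA opprD addrACA.
- by rewrite -!scalemxAl !bracketZr -scalemxAl -scalerDr -scalerBr.
rewrite !(map_delta f) (map_str f) -!(map_mxM, map_bracket) h //.
by rewrite raddfD subrr.
Qed.

Lemma derived_by_detect (K : fieldType) (n : nat) (D : 'M[K]_n -> Prop)
    (A : kalg K) (phi : law n A) :
  (forall a b : A,
     (forall (B : kalg K) (f : khom A B),
        derived_by D (map_law f phi) -> f a = f b) -> a = b) ->
  derived_by D phi.
Proof.
move=> sep d Dd /= x y; apply/rowP => k; apply: sep => B f h.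
set u := LHS; set v := RHS.
have : map_mx f (bracket phi x y *m map_mx (kalg_str A) d)
    = map_mx f (bracket phi (x *m map_mx (kalg_str A) d) y
              + bracket phi x (y *m map_mx (kalg_str A) d)).
  by rewrite raddfD /= !(map_bracket, map_mxM) -map_str h.
by move/rowP/(_ k); rewrite [LHS]mxE [RHS]mxE.
Qed.

Definition derived_cond (K : fieldType) (n : nat) (D : 'M[K]_n -> Prop) :
    closed_cond K n :=
  ClosedCond (@derived_by_map K n D) (@derived_by_detect K n D).

Section Conjunction.
Variables (K : fieldType) (m : nat) (P Q : closed_cond K m).

Definition both (A : kalg K) (phi : law m A) : Prop := P A phi /\ Q A phi.

Lemma both_map (A B : kalg K) (f : khom A B) (phi : law m A) :
  both phi -> both (map_law f phi).
Proof. by case=> p q; split; apply: cond_map. Qed.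

Lemma both_detect (A : kalg K) (phi : law m A) :
  (forall a b : A,
     (forall (B : kalg K) (f : khom A B), both (map_law f phi) -> f a = f b)
     -> a = b) ->
  both phi.
Proof.
by move=> sep; split; apply: cond_detect => a b h; apply: sep => B f [p q];
  apply: h.
Qed.

Definition and_cond : closed_cond K m := ClosedCond both_map both_detect.

End Conjunction.

Definition lie_scheme (K : fieldType) (m : nat) : affine_scheme K :=
  law_scheme (lie_cond K m).

Definition lie_law (K : fieldType) (m : nat)
    (phi : lie_scheme K m (kself K)) : law m K := sval phi.

Definition fixed_scheme (K : fieldType) (m : nat)
    (S : {set 'I_m * 'I_m * 'I_m}) (phi0 : law m K) : affine_scheme K :=
  law_scheme (and_cond (lie_cond K m) (fixed_cond S phi0)).

Definition derived_scheme (K : fieldType) (n : nat) (D : 'M[K]_n -> Prop) :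
    affine_scheme K :=
  law_scheme (and_cond (lie_cond K n) (derived_cond D)).

Section Subspaces.
Variables (K : fieldType) (m : nat) (phi : law m K).

Definition brackets (U V : {vspace 'rV[K]_m}) : {vspace 'rV[K]_m} :=
  <<[seq bracket phi u v | u <- vbasis U, v <- vbasis V]>>%VS.

Definition lie_subalgebra (U : {vspace 'rV[K]_m}) : Prop :=
  (brackets U U <= U)%VS.

Definition lie_ideal (U : {vspace 'rV[K]_m}) : Prop :=
  (brackets fullv U <= U)%VS.

Definition lower_central (U : {vspace 'rV[K]_m}) (k : nat) :
  {vspace 'rV[K]_m} := iter k (brackets U) U.

Definition lie_nilpotent (U : {vspace 'rV[K]_m}) : Prop :=
  exists k, lower_central U k = 0%VS.

(* The adjoint representation of the subalgebra U is semisimple.              *)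
Definition lie_reductive (U : {vspace 'rV[K]_m}) : Prop :=
  forall I : {vspace 'rV[K]_m}, (I <= U)%VS -> (brackets U I <= I)%VS ->
  exists J : {vspace 'rV[K]_m},
    [/\ (J <= U)%VS, (brackets U J <= J)%VS,
        (I + J)%VS = U & (I :&: J)%VS = 0%VS].

Variable n : nat.

Definition nil_part : {vspace 'rV[K]_m} :=
  <<[seq (delta_mx 0 i)%R | i : 'I_m <- enum 'I_m & (i < n)%N]>>%VS.

Definition red_part : {vspace 'rV[K]_m} :=
  <<[seq (delta_mx 0 i)%R | i : 'I_m <- enum 'I_m & (n <= i)%N]>>%VS.

(* The sum of red_part and nil_part is always direct and equal to K^m.        *)
Definition semidirect : Prop :=
  [/\ lie_subalgebra red_part, lie_reductive red_part,
      lie_ideal nil_part & lie_nilpotent nil_part].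

(* y *m pid_mx n is the image of y under the inclusion of K^n into K^m.       *)
Definition ad_restriction (d : 'M[K]_n) : Prop :=
  exists2 x : 'rV[K]_m, x \in red_part &
  forall y : 'rV[K]_n,
    (y *m d) *m pid_mx n = bracket phi x (y *m (pid_mx n : 'M[K]_(n, m))).

End Subspaces.

Definition mixed_indices (m n : nat) : {set 'I_m * 'I_m * 'I_m} :=
  [set a : 'I_m * 'I_m * 'I_m |
     let: (i, j, k) := a in
     (i < j)%N && [|| (n <= i)%N, (n <= j)%N | (n <= k)%N]].

(* Main.v *)
(** A law [phi] in the left-hand scheme agrees with [phi0] on every index
    leaving [n], so it is determined by its restriction [psi] to [n].  The
    Jacobi identity of [phi] on three vectors of [n] is that of [psi]; on one
    vector [x] of [R] and two of [n] it says that [ad x] derives [psi]; with two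
    vectors in [R] all brackets involved are those of [phi0], because [R] is a
    subalgebra and [n] an ideal.  Hence restriction to [n] and extension by
    [phi0] are mutually inverse, naturally in the algebra. *)
Require Import Defs.
From mathcomp Require Import all_boot all_order all_algebra.

Set Implicit Arguments.
Unset Strict Implicit.
Unset Printing Implicit Defensive.

Import GRing.Theory.
Local Open Scope ring_scope.

(** * Brackets and the Jacobi sum read off structure constants *)

Section Law.
Variables (A : comPzRingType) (m : nat) (phi : law m A).
Local Notation e i := (delta_mx 0 i : 'rV[A]_m).

Lemma bracket_delta i j : bracket phi (e i) (e j) = \row_k phi (i, j, k).
Proof.
apply/rowP => k; rewrite !mxE (bigD1 i) //= (bigD1 j) //= !mxE !eqxx !mul1r.
rewrite big1 ?addr0 => [|q /negPf qj]; last by rewrite !mxE qj mulr0 mul0r.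
rewrite big1 ?addr0 // => p /negPf pi.
by rewrite big1 // => q _; rewrite !mxE pi !mul0r.
Qed.

Lemma bracket0l x : bracket phi 0 x = 0.
Proof. by have := bracketZl phi 0 0 x; rewrite !scale0r. Qed.

Lemma bracket0r x : bracket phi x 0 = 0.
Proof. by have := bracketZr phi 0 0 x; rewrite !scale0r. Qed.

(** Splitting off one basis vector at a time, the cross terms cancel by antisymmetry and the square
    term vanishes by the diagonal condition. That condition is separate because antisymmetry alone
    gives only twice the square, and 2 may be a zero divisor in [A]. *)
Lemma bracket_alternating :
  (forall i k, phi (i, i, k) = 0) ->
  (forall i j k, phi (i, j, k) + phi (j, i, k) = 0) ->
  forall x, bracket phi x x = 0.
Proof.
move=> alt anti.
have antib x y : bracket phi x y + bracket phi y x = 0.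
  (* Swapping the sums in the second term pairs [phi (i, j, k)] with [phi (j, i, k)]. *)
  apply/rowP => k; rewrite !mxE [X in _ + X]exchange_big -big_split big1 //= => i _.
  rewrite -big_split big1 //= => j _.
  by rewrite [y 0 j * _]mulrC -mulrDr anti mulr0.
move=> x; rewrite [x]row_sum_delta; elim/big_rec: _ => [|i y _ IH].
  exact: bracket0l.
rewrite bracketDl !bracketDr IH addr0 -addrA antib addr0.
rewrite bracketZl bracketZr bracket_delta.
have -> : \row_k phi (i, i, k) = 0 by apply/rowP => k; rewrite !mxE alt.
by rewrite !scaler0.
Qed.

Lemma bracketN x y : (forall x, bracket phi x x = 0) ->
  bracket phi x y = - bracket phi y x.
Proof. by move=> alt; apply/eqP; rewrite -addr_eq0 bracket_antisym. Qed.

Lemma law_alt i k : (forall x, bracket phi x x = 0) -> phi (i, i, k) = 0.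
Proof. by move/(_ (e i))/rowP/(_ k); rewrite bracket_delta !mxE. Qed.

Lemma law_antisym i j k : (forall x, bracket phi x x = 0) ->
  phi (i, j, k) = - phi (j, i, k).
Proof. by move/(bracketN (e i) (e j))/rowP/(_ k); rewrite !bracket_delta !mxE. Qed.

Lemma bracketNr x y : bracket phi x (- y) = - bracket phi x y.
Proof. by rewrite -!scaleN1r bracketZr. Qed.

Definition jacobiator x y z :=
  bracket phi x (bracket phi y z) + bracket phi y (bracket phi z x)
  + bracket phi z (bracket phi x y).

Lemma jacobiator_rot x y z : jacobiator x y z = jacobiator y z x.
Proof. by rewrite /jacobiator addrC addrA addrC addrA. Qed.

(** The Jacobi sum is linear in each of its three arguments. *)
Lemma jacobiator_basis :
  (forall i j k, jacobiator (e i) (e j) (e k) = 0) ->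
  forall x y z, jacobiator x y z = 0.
Proof.
rewrite /jacobiator => h x y z.
move: x; apply: row_basis_ind => [x x'|a x|i].
- by rewrite !(bracketDl, bracketDr) [X in X + _ = _]addrACA [LHS]addrACA.
- by rewrite !(bracketZl, bracketZr) !scalerDr.
move: y; apply: row_basis_ind => [y y'|a y|j].
- by rewrite !(bracketDl, bracketDr) [X in X + _ = _]addrACA [LHS]addrACA.
- by rewrite !(bracketZl, bracketZr) !scalerDr.
move: z; apply: row_basis_ind => [z z'|a z|k].
- by rewrite !(bracketDl, bracketDr) [X in X + _ = _]addrACA [LHS]addrACA.
- by rewrite !(bracketZl, bracketZr) !scalerDr.
exact: h.
Qed.

End Law.

(** * Restricting laws to the first n coordinates and extending them back *)

Section Restriction.
Variables (n m : nat) (le_nm : (n <= m)%N).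
Local Notation w := (widen_ord le_nm).

Definition restr_law (A : Type) (phi : law m A) : law n A :=
  [ffun a => phi (w a.1.1, w a.1.2, w a.2)].

(** [insub] succeeds exactly on indices below n, so one index outside that range is enough to fall
    back on [mu]. *)
Definition ext_law (A : Type) (mu : law m A) (psi : law n A) : law m A :=
  [ffun a => if (insub (val a.1.1), insub (val a.1.2), insub (val a.2))
               is (Some i, Some j, Some k) then psi (i, j, k) else mu a].

Lemma ext_law_in (A : Type) (mu : law m A) (psi : law n A) i j k :
  ext_law mu psi (w i, w j, w k) = psi (i, j, k).
Proof. by rewrite ffunE /= !valK. Qed.

Lemma ext_law_out (A : Type) (mu : law m A) (psi : law n A) (i j k : 'I_m) :
  [|| (n <= i)%N, (n <= j)%N | (n <= k)%N] ->
  ext_law mu psi (i, j, k) = mu (i, j, k).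
Proof.
rewrite ffunE /=; case: insubP => // i' + _; case: insubP => // j' + _.
by case: insubP => // k' + _; rewrite !ltnNge => /negPf-> /negPf-> /negPf->.
Qed.

Lemma widenP (i : 'I_m) : (n <= i)%N \/ exists i', i = w i'.
Proof.
case: (leqP n i) => h; [by left | right].
by exists (Ordinal h); apply: val_inj.
Qed.

Variable A : comPzRingType.
Local Notation E := (pid_mx n : 'M[A]_(n, m)).
Local Notation e i := (delta_mx 0 i).

Lemma delta_pid (i : 'I_n) : e i *m E = e (w i) :> 'rV[A]_m.
Proof.
apply/rowP => k; rewrite -rowE !mxE eqxx ltn_ord andbT /=.
by rewrite -val_eqE eq_sym.
Qed.

(** Projection onto the first n coordinates is a left inverse. Identities in [A^n] can thus be
    proved after inclusion into [A^m]. *)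
Lemma mul_pid_inj : injective (fun x : 'rV[A]_n => x *m E).
Proof.
move=> x y /(congr1 (mulmx^~ (pid_mx n : 'M[A]_(m, n)))).
by rewrite -!mulmxA mul_pid_mx minnn (minn_idPr le_nm) pid_mx_1 !mulmx1.
Qed.

Lemma bracket_restr (phi : law m A) :
  (forall (i j : 'I_n) (k : 'I_m), (n <= k)%N -> phi (w i, w j, k) = 0) ->
  forall x y : 'rV[A]_n,
  bracket phi (x *m E) (y *m E) = bracket (restr_law phi) x y *m E.
Proof.
move=> ideal x y; apply/eqP; rewrite -subr_eq0; apply/eqP.
move: x; apply: row_basis_ind => [x x'|a x|i].
- by rewrite !(bracketDl, mulmxDl) opprD addrACA.
- by rewrite -scalemxAl !bracketZl -scalemxAl scalerBr.
move: y; apply: row_basis_ind => [y y'|a y|j].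
- by rewrite !(bracketDr, mulmxDl) opprD addrACA.
- by rewrite -scalemxAl !bracketZr -scalemxAl scalerBr.
rewrite !delta_pid !bracket_delta; apply/rowP => k; rewrite !mxE.
case: (widenP k) => [nk|[k' ->]].
  (* Beyond n both sides vanish: the bracket by hypothesis, the included vector because those
     columns of [E] are zero. *)
  rewrite ideal // big1 ?subrr // => l _; rewrite !mxE [(l < n)%N]ltn_ord andbT.
  by rewrite ltn_eqF ?mulr0 // (leq_trans (ltn_ord l)).
rewrite (bigD1 k') //= big1 => [|l lk]; last first.
  by rewrite !mxE -val_eqE in lk *; rewrite (negPf lk) mulr0.
by rewrite !mxE ffunE eqxx /= ltn_ord mulr1 addr0 subrr.
Qed.

Lemma restr_lie (phi : law m A) :
  (forall (i j : 'I_n) (k : 'I_m), (n <= k)%N -> phi (w i, w j, k) = 0) ->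
  is_lie phi -> is_lie (restr_law phi).
Proof.
move=> /bracket_restr br [alt jac]; split=> [x|x y z]; apply: mul_pid_inj.
  by rewrite /= -br alt mul0mx.
by rewrite /= !mulmxDl -!br jac mul0mx.
Qed.

(** Coefficients with first index below n meet a zero coordinate of [r]. With [r] in R, the bracket
    therefore involves prescribed coefficients only. *)
Lemma bracket_eq_l (phi mu : law m A) :
  (forall i j k : 'I_m, (n <= i)%N -> phi (i, j, k) = mu (i, j, k)) ->
  forall r y : 'rV[A]_m, (forall i : 'I_m, (i < n)%N -> r 0 i = 0) ->
  bracket phi r y = bracket mu r y.
Proof.
move=> eq r y r0; apply/rowP => k; rewrite !mxE.
apply: eq_bigr => i _; apply: eq_bigr => j _.
by case: (leqP n i) => h; [rewrite eq | rewrite r0 // !mul0r].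
Qed.

(** * The Jacobi identity for the extended law *)

Section Extension.
Variables (mu : law m A) (psi : law n A).
Hypotheses (mu_lie : is_lie mu) (psi_lie : is_lie psi).
Hypothesis R_subalgebra : forall i j k : 'I_m,
  (n <= i)%N -> (n <= j)%N -> (k < n)%N -> mu (i, j, k) = 0.
Hypothesis n_ideal : forall i j k : 'I_m,
  (j < n)%N -> (n <= k)%N -> mu (i, j, k) = 0.
Hypothesis psi_der : forall i : 'I_m, (n <= i)%N ->
  exists d : 'M[A]_n,
    (forall y : 'rV[A]_n, (y *m d) *m E = bracket mu (e i) (y *m E)) /\
    (forall x y : 'rV[A]_n,
       bracket psi x y *m d = bracket psi (x *m d) y + bracket psi x (y *m d)).
Local Notation phi := (ext_law mu psi).

Lemma ext_alternating x : bracket phi x x = 0.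
Proof.
have [mu_alt _] := mu_lie; have [psi_alt _] := psi_lie; move: x.
apply: bracket_alternating => [i k|i j k].
  case: (widenP i) => [h|[i' ->]]; first by rewrite ext_law_out ?h ?law_alt.
  case: (widenP k) => [h|[k' ->]]; first by rewrite ext_law_out ?h ?orbT ?law_alt.
  by rewrite ext_law_in law_alt.
case: (widenP i) => [h|[i' ->]].
  by rewrite !ext_law_out ?h ?orbT // [X in X + _]law_antisym // addNr.
case: (widenP j) => [h|[j' ->]].
  by rewrite !ext_law_out ?h ?orbT // [X in X + _]law_antisym // addNr.
case: (widenP k) => [h|[k' ->]].
  by rewrite !ext_law_out ?h ?orbT // [X in X + _]law_antisym // addNr.
by rewrite !ext_law_in [X in X + _]law_antisym // addNr.
Qed.

Lemma ext_bracket_in (x y : 'rV[A]_n) :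
  bracket phi (x *m E) (y *m E) = bracket psi x y *m E.
Proof.
rewrite bracket_restr => [|i j k nk]; last first.
  by rewrite ext_law_out ?nk ?orbT // n_ideal //=.
congr (bracket _ x y *m _); apply/ffunP => -[[i j] k].
by rewrite ffunE ext_law_in.
Qed.

Lemma ext_bracket_out (r y : 'rV[A]_m) :
  (forall i : 'I_m, (i < n)%N -> r 0 i = 0) ->
  bracket phi r y = bracket mu r y.
Proof. by apply: bracket_eq_l => i j k ni; rewrite ext_law_out ?ni. Qed.

Lemma ext_bracket_delta (i : 'I_m) (y : 'rV[A]_m) : (n <= i)%N ->
  bracket phi (e i) y = bracket mu (e i) y.
Proof.
move=> ni; apply: ext_bracket_out => p pn; rewrite mxE eqxx /=.
by case: eqP pn => // ->; rewrite ltnNge ni.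
Qed.

Lemma ext_jacobi_RR (i j : 'I_m) (z : 'rV[A]_m) : (n <= i)%N -> (n <= j)%N ->
  jacobiator phi (e i) (e j) z = 0.
Proof.
move=> ni nj; have [mu_alt mu_jac] := mu_lie.
have anti := bracketN _ _ ext_alternating.
rewrite -[RHS](mu_jac (e i) (e j) z) /jacobiator.
rewrite ![bracket phi (e i) _]ext_bracket_delta // [bracket phi z (e i)]anti.
rewrite ![bracket phi (e j) _]ext_bracket_delta //.
rewrite ![bracket phi (e i) _]ext_bracket_delta //.
rewrite -(bracketN z) //; congr (_ + _).
(* In the last term the inner bracket lies in R, by [R_subalgebra]; antisymmetry moves it to the
   left, where [phi] and [mu] agree. *)
rewrite anti ext_bracket_out -?(bracketN z) // => k kn.
by rewrite bracket_delta mxE R_subalgebra.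
Qed.

(** With [d] the matrix of ad [e i] on n, the sum is [[u,v]d - [u,vd] + [v,ud]]; the derivation rule
    reduces it to [[ud,v] + [v,ud]]. *)
Lemma ext_jacobi_Rnn (i : 'I_m) (u v : 'rV[A]_n) : (n <= i)%N ->
  jacobiator phi (e i) (u *m E) (v *m E) = 0.
Proof.
move=> ni; have [d [dE der]] := psi_der ni; have [psi_alt _] := psi_lie.
have adE y : bracket phi (e i) (y *m E) = y *m d *m E.
  by rewrite ext_bracket_delta // dE.
rewrite /jacobiator [bracket phi (v *m E) (e i)](bracketN _ _ ext_alternating).
rewrite !adE bracketNr !ext_bracket_in adE der mulmxDl addrK.
by rewrite -mulmxDl bracket_antisym // mul0mx.
Qed.

Lemma ext_lie : is_lie phi.
Proof.
split; first exact: ext_alternating.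
apply: jacobiator_basis => i j k.
(* Cyclic invariance brings the vectors of R to the front, leaving the cases RR*, Rnn and nnn. *)
case: (widenP i) => [ni|[i' ->]]; case: (widenP j) => [nj|[j' ->]];
  case: (widenP k) => [nk|[k' ->]].
- exact: ext_jacobi_RR.
- exact: ext_jacobi_RR.
- by rewrite -jacobiator_rot; apply: ext_jacobi_RR.
- by rewrite -!delta_pid; apply: ext_jacobi_Rnn.
- by rewrite jacobiator_rot; apply: ext_jacobi_RR.
- by rewrite jacobiator_rot -!delta_pid; apply: ext_jacobi_Rnn.
- by rewrite -jacobiator_rot -!delta_pid; apply: ext_jacobi_Rnn.
have [_ psi_jac] := psi_lie.
by rewrite /jacobiator -!delta_pid !ext_bracket_in -!mulmxDl psi_jac mul0mx.
Qed.

End Extension.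
End Restriction.

(** * Vanishing coefficients of [phi0] and scalar extension of its adjoint action *)

Section Semidirect.
Variables (K : fieldType) (m n : nat) (phi0 : law m K).

Lemma mem_brackets (U V : {vspace 'rV[K]_m}) u v :
  u \in U -> v \in V -> bracket phi0 u v \in brackets phi0 U V.
Proof.
move=> /coord_vbasis-> /coord_vbasis->.
elim/big_rec: _ => [|i x _ IH]; first by rewrite bracket0l mem0v.
rewrite bracketDl memvD // bracketZl memvZ // {x IH}.
elim/big_rec: _ => [|j x _ IH]; first by rewrite bracket0r mem0v.
rewrite bracketDr memvD // bracketZr memvZ // memv_span //.
by apply/allpairsP; exists ((vbasis U)`_i, (vbasis V)`_j); rewrite !mem_nth ?size_tuple.
Qed.

Lemma span_delta_coord (P : pred 'I_m) (x : 'rV[K]_m) (i : 'I_m) :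
  x \in <<[seq (delta_mx 0 i)%R | i : 'I_m <- enum 'I_m & P i]>>%VS ->
  ~~ P i -> x 0 i = 0.
Proof.
move=> + nPi; set X := [seq _ | _ <- _ & _] => xX.
have [k ->] : exists k : 'I_(size X) -> K, x = \sum_p k p *: X`_p.
  by exists (fun p => coord (in_tuple X) p x); exact: (@coord_span _ _ _ (in_tuple X)).
rewrite summxE big1 // => p _; rewrite mxE.
have /mapP[q] : X`_p \in X by rewrite mem_nth.
rewrite mem_filter => /andP[Pq _] ->; rewrite mxE eqxx /=.
by case: eqP nPi Pq => [-> /negPf->|]; rewrite ?mulr0.
Qed.

Lemma delta_in_span (P : pred 'I_m) (i : 'I_m) : P i ->
  (delta_mx 0 i : 'rV[K]_m) \in
    <<[seq (delta_mx 0 i)%R | i : 'I_m <- enum 'I_m & P i]>>%VS.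
Proof.
by move=> Pi; rewrite memv_span //; apply: map_f; rewrite mem_filter Pi mem_enum.
Qed.

Lemma red_part_coord (x : 'rV[K]_m) (i : 'I_m) :
  x \in red_part K m n -> (i < n)%N -> x 0 i = 0.
Proof. by rewrite ltnNge; apply: span_delta_coord. Qed.

Lemma subalgebra_coef : lie_subalgebra phi0 (red_part K m n) ->
  forall i j k : 'I_m, (n <= i)%N -> (n <= j)%N -> (k < n)%N ->
  phi0 (i, j, k) = 0.
Proof.
move=> /subvP sub i j k ni nj kn.
have /red_part_coord/(_ kn) := sub _ (mem_brackets
  (delta_in_span (P := fun i : 'I_m => (n <= i)%N) ni)
  (delta_in_span (P := fun i : 'I_m => (n <= i)%N) nj)).
by rewrite bracket_delta mxE.
Qed.

Lemma ideal_coef : lie_ideal phi0 (nil_part K m n) ->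
  forall i j k : 'I_m, (j < n)%N -> (n <= k)%N -> phi0 (i, j, k) = 0.
Proof.
move=> /subvP sub i j k jn; rewrite leqNgt => nk.
have /span_delta_coord/(_ nk) := sub _ (mem_brackets (memvf (delta_mx 0 i))
  (delta_in_span (P := fun i : 'I_m => (i < n)%N) jn)).
by rewrite bracket_delta mxE.
Qed.

(** Since n is an ideal, ad [e_i] maps it to itself, so truncating its matrix to n loses nothing. *)
Lemma ad_restriction_delta (le_nm : (n <= m)%N) (i : 'I_m) :
  lie_ideal phi0 (nil_part K m n) -> (n <= i)%N ->
  let d := \matrix_(j, k) phi0 (i, widen_ord le_nm j, widen_ord le_nm k) in
  forall y : 'rV[K]_n,
  (y *m d) *m pid_mx n
    = bracket phi0 (delta_mx 0 i) (y *m (pid_mx n : 'M[K]_(n, m))).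
Proof.
move=> /ideal_coef ideal ni d y; apply/eqP; rewrite -subr_eq0; apply/eqP.
move: y; apply: row_basis_ind => [y y'|a y|j].
- by rewrite !mulmxDl bracketDr opprD addrACA.
- by rewrite -!scalemxAl bracketZr scalerBr.
rewrite (delta_pid le_nm) bracket_delta -rowE; apply/rowP => k; rewrite !mxE.
case: (widenP le_nm k) => [nk|[k' ->]].
  rewrite ideal //= big1 ?subrr // => l _; rewrite !mxE [(l < n)%N]ltn_ord andbT.
  by rewrite ltn_eqF ?mulr0 // (leq_trans (ltn_ord l)).
rewrite (bigD1 k') //= big1 => [|l lk]; last first.
  by rewrite !mxE -val_eqE in lk *; rewrite (negPf lk) mulr0.
by rewrite !mxE eqxx /= ltn_ord mulr1 addr0 subrr.
Qed.

(** By linearity over [A] it is enough to test basis vectors, and these come from [K]. *)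
Lemma map_ad_restriction (A : kalg K) (d : 'M[K]_n) (x : 'rV[K]_m) :
  (forall y : 'rV[K]_n,
    (y *m d) *m pid_mx n = bracket phi0 x (y *m (pid_mx n : 'M[K]_(n, m)))) ->
  forall y : 'rV[A]_n,
    (y *m map_mx (kalg_str A) d) *m pid_mx n
    = bracket (map_law (kalg_str A) phi0) (map_mx (kalg_str A) x)
        (y *m (pid_mx n : 'M[A]_(n, m))).
Proof.
move=> h y; apply/eqP; rewrite -subr_eq0; apply/eqP.
move: y; apply: row_basis_ind => [y y'|a y|j].
- by rewrite !mulmxDl bracketDr opprD addrACA.
- by rewrite -!scalemxAl bracketZr scalerBr.
rewrite (map_delta (kalg_str A)) -!(map_pid_mx (kalg_str A)).
by rewrite -!map_mxM -map_bracket h subrr.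
Qed.

Lemma is_lie_scalars (A : kalg K) :
  is_lie phi0 -> is_lie (map_law (kalg_str A) phi0).
Proof.
(* The structure map of [A] is itself a morphism of algebras from [K]. *)
exact: (@is_lie_map K m (kself K) A
  (@KHom K (kself K) A (kalg_str A) (fun=> erefl)) phi0).
Qed.

(** * Restriction and extension as inverse maps between points *)

Variable (le_nm : (n <= m)%N).
Hypotheses (phi0_lie : is_lie phi0) (phi0_sd : semidirect phi0 n).
Local Notation P := (and_cond (lie_cond K m) (fixed_cond (mixed_indices m n) phi0)).
Local Notation Q := (and_cond (lie_cond K n)
  (derived_cond (ad_restriction phi0 (n := n)))).

(** [mixed_indices] prescribes only [i < j]; alternation of both laws recovers [j < i] and the
    diagonal. *)
Lemma fixed_all (A : kalg K) (phi : law m A) : P A phi ->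
  forall i j k : 'I_m, [|| (n <= i)%N, (n <= j)%N | (n <= k)%N] ->
  phi (i, j, k) = map_law (kalg_str A) phi0 (i, j, k).
Proof.
case=> -[alt _] fix_phi i j k mixed.
have [alt0 _] := is_lie_scalars A phi0_lie.
case: (ltngtP i j) => [ij|ji|/val_inj ij].
- by rewrite fix_phi ?inE ?ij // ffunE.
- rewrite law_antisym // [RHS]law_antisym // fix_phi ?ffunE // inE ji.
  by rewrite orbCA.
- by rewrite ij !law_alt.
Qed.

Lemma restr_derived (A : kalg K) (phi : law m A) :
  P A phi -> Q A (restr_law le_nm phi).
Proof.
move=> Pphi; have [_ _ /ideal_coef ideal0 _] := phi0_sd.
have [phi_lie _] := Pphi; have [alt jac] := phi_lie.
have ideal (i j : 'I_n) (k : 'I_m) : (n <= k)%N ->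
    phi (widen_ord le_nm i, widen_ord le_nm j, k) = 0.
  by move=> nk; rewrite (fixed_all Pphi) ?nk ?orbT // ffunE ideal0 ?rmorph0 //=.
split; first exact: restr_lie.
move=> d [x xR dE0] /= u v.
have dE := map_ad_restriction (A := A) dE0.
set dA := map_mx _ d in dE *; set xA := map_mx _ x in dE.
(* [xA] has no coordinates in n, so [phi] brackets with it as [phi0] does, and this action is
   [dA]. *)
have adE y : bracket phi xA (y *m (pid_mx n : 'M[A]_(n, m))) = y *m dA *m pid_mx n.
  rewrite dE; apply: (@bracket_eq_l n) => [i j k ni|i ilt].
    by rewrite (fixed_all Pphi) ?ni.
  by rewrite mxE (red_part_coord xR) ?rmorph0.
apply: (mul_pid_inj le_nm) => /=.
rewrite -adE mulmxDl -!(bracket_restr ideal) -!adE.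
(* With everything on one side, the derivation rule is the Jacobi identity for [xA], u and v, up to
   antisymmetry in two terms. *)
apply/eqP; rewrite -subr_eq0 opprD addrA addrAC; apply/eqP.
rewrite -[RHS](jac xA (u *m pid_mx n) (v *m pid_mx n)); congr (_ + _ + _).
  by rewrite [bracket phi _ xA](bracketN _ _ alt) bracketNr.
by rewrite [RHS](bracketN _ _ alt).
Qed.

Lemma ext_fixed (A : kalg K) (psi : law n A) :
  Q A psi -> P A (ext_law (map_law (kalg_str A) phi0) psi).
Proof.
case=> psi_lie psi_der; have [Rsub _ nideal _] := phi0_sd; split; last first.
  move=> [[i j] k]; rewrite inE => /andP[_ mixed].
  by rewrite ext_law_out // ffunE.
apply: (ext_lie le_nm) => //; first exact: is_lie_scalars.
- by move=> i j k ni nj kn; rewrite ffunE (subalgebra_coef Rsub) ?rmorph0.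
- by move=> i j k jn nk; rewrite ffunE (ideal_coef nideal) ?rmorph0.
(* The derivation required for [e_i] is the scalar extension of the matrix of ad [e_i] on n; it
   belongs to the family that [psi] respects, as [e_i] is in R. *)
move=> i ni; have dE := ad_restriction_delta le_nm nideal ni.
set d := \matrix_(j, k) _ in dE; exists (map_mx (kalg_str A) d); split.
  by rewrite (map_delta (kalg_str A)); apply: map_ad_restriction.
by apply: psi_der; exists (delta_mx 0 i) => //; apply: delta_in_span.
Qed.

Lemma restr_ext (A : Type) (mu : law m A) (psi : law n A) :
  restr_law le_nm (ext_law mu psi) = psi.
Proof. by apply/ffunP => -[[i j] k]; rewrite ffunE ext_law_in. Qed.

Lemma ext_restr (A : kalg K) (phi : law m A) : P A phi ->
  ext_law (map_law (kalg_str A) phi0) (restr_law le_nm phi) = phi.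
Proof.
move=> Pphi; apply/ffunP => -[[i j] k].
have out := ext_law_out (map_law (kalg_str A) phi0) (restr_law le_nm phi).
case: (widenP le_nm i) => [h|[i' ->]]; first by rewrite out ?(fixed_all Pphi) ?h.
case: (widenP le_nm j) => [h|[j' ->]].
  by rewrite out ?(fixed_all Pphi) ?h ?orbT.
case: (widenP le_nm k) => [h|[k' ->]].
  by rewrite out ?(fixed_all Pphi) ?h ?orbT.
by rewrite ext_law_in ffunE.
Qed.

Lemma restriction_iso : scheme_iso (law_scheme P) (law_scheme Q).
Proof.
exists (fun A x => exist _ (restr_law le_nm (sval x)) (restr_derived (svalP x))).
split=> [A B f x|A].
  (* Naturality: restriction selects coefficients, while a morphism acts on each coefficient
     separately. *)
  by apply: law_points_inj; apply/ffunP => a; rewrite /= !ffunE.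
exists (fun y => exist _ _ (ext_fixed (svalP y))) => x.
  by apply: (@law_points_inj K m P A); apply: ext_restr (svalP x).
by apply: (@law_points_inj K n Q A); apply: restr_ext.
Qed.

End Semidirect.

Theorem proposition1p6 (K : closedFieldType) (charK : [pchar K]%R =i pred0)
    (m n : nat) (le_nm : (n <= m)%N) (phi0 : lie_scheme K m (kself K))
    (g_semidirect : semidirect (lie_law phi0) n) :
  scheme_iso (fixed_scheme (mixed_indices m n) (lie_law phi0))
             (derived_scheme (ad_restriction (lie_law phi0) (n := n))).
Proof. exact: restriction_iso le_nm (svalP phi0) g_semidirect. Qed.
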